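(* Let $R$ be a p.q.-Baer $*$-ring with at least four central projections. Then the complement $\Gamma^*_s(R)^c$ of the strong zero-divisor graph of $R$ is connected if and only if $R$ has at least six central projections, i.e. $|CP(R)|\geq 6$.
   Context: A $*$-ring is a ring $R$ with an involution $x\mapsto x^*$. A projection is an element $e$ with $e^2=e=e^*$; a central projection is a projection in the centre of $R$; $CP(R)$ denotes the set of central projections of $R$. For $S\subseteq R$, $r_R(S)=\{x\in R: sx=0\ \forall s\in S\}$. $R$ is a p.q.-Baer $*$-ring if for every $a\in R$, $r_R(aR)=eR$ for some projection $e\in R$. The strong zero-divisor graph $\Gamma^*_s(R)$ is the simple undirected graph with vertex set $\{0\neq a\in R: r_R(aR)\neq\{0\}\}$, in which distinct vertices $a,b$ are adjacent iff $aRb^*=0$. The complement $G^c$ of a simple graph $G$ has the same vertices, with distinct vertices adjacent iff they are not adjacent in $G$. *)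

(* Defs.v *)
From HB Require Import structures.
From mathcomp Require Import all_boot all_algebra.
From mathcomp Require Import boolp classical_sets cardinality.

Set Implicit Arguments.
Unset Strict Implicit.
Unset Printing Implicit Defensive.

Import GRing.Theory.
Local Open Scope classical_set_scope.
Local Open Scope ring_scope.

(* The unit of [pzRingType] is no restriction for p.q.-Baer *-rings:
   r_R(0R) = R = eR with e a projection makes e a two-sided unit. *)
HB.mixin Record isStarRing R of GRing.PzRing R := {
  star : R -> R;
  starD : {morph star : x y / x + y};
  starM : forall x y, star (x * y) = star y * star x;
  starK : involutive star
}.

#[short(type="starRingType")]
HB.structure Definition StarRing := {R of isStarRing R & GRing.PzRing R}.

Section StarRingTheory.
Variable R : starRingType.
Implicit Types (a b e x y : R) (S : set R).

Definition projection e : Prop := e * e = e /\ star e = e.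

Definition central e : Prop := forall x, e * x = x * e.

Definition central_projections : set R := [set e | projection e /\ central e].

Definition right_annihilator S : set R := [set x | forall s, S s -> s * x = 0].

Definition principal_right_ideal a : set R := range ( *%R a).

Definition pq_Baer : Prop :=
  forall a, exists2 e, projection e &
    right_annihilator (principal_right_ideal a) = principal_right_ideal e.

Lemma star0 : star (0 : R) = 0.
Proof. by apply: (addIr (star (0 : R))); rewrite -starD !add0r. Qed.

End StarRingTheory.

Arguments central_projections : clear implicits.
Arguments pq_Baer : clear implicits.

Record sgraph (T : Type) := SGraph {
  vertex : set T;
  adj : T -> T -> Prop;
  adj_vertex : forall x y, adj x y -> vertex x /\ vertex y;
  adj_irr : forall x, ~ adj x x;
  adj_sym : forall x y, adj x y -> adj y x
}.

Section GraphTheory.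
Variables (T : Type) (G : sgraph T).

Definition compl_adj (x y : T) : Prop :=
  [/\ vertex G x, vertex G y, x <> y & ~ adj G x y].

Lemma compl_adj_vertex x y : compl_adj x y -> vertex G x /\ vertex G y.
Proof. by case. Qed.

Lemma compl_adj_irr x : ~ compl_adj x x.
Proof. by case. Qed.

Lemma compl_adj_sym x y : compl_adj x y -> compl_adj y x.
Proof.
case=> vx vy xy nxy; split=> //; first exact: nesym.
by move=> yx; apply: nxy; apply: adj_sym.
Qed.

Definition complement : sgraph T :=
  SGraph compl_adj_vertex compl_adj_irr compl_adj_sym.

Definition connected : Prop :=
  forall x y, vertex G x -> vertex G y ->
    exists2 p : seq T, path (fun u v => `[< adj G u v >]) x p & last x p = y.

End GraphTheory.

Section StrongZeroDivisorGraph.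
Variable R : starRingType.

Definition szd_vertex : set R :=
  [set a | a <> 0 /\
           right_annihilator (principal_right_ideal a) <> [set 0]].

Definition szd_adj (a b : R) : Prop :=
  [/\ szd_vertex a, szd_vertex b, a <> b & forall r, a * r * star b = 0].

Lemma szd_adj_vertex a b : szd_adj a b -> szd_vertex a /\ szd_vertex b.
Proof. by case. Qed.

Lemma szd_adj_irr a : ~ szd_adj a a.
Proof. by case. Qed.

Lemma szd_adj_sym a b : szd_adj a b -> szd_adj b a.
Proof.
case=> va vb ab h; split=> //; first exact: nesym.
by move=> r; apply: (can_inj starK); rewrite star0 !starM starK mulrA h.
Qed.

Definition strong_zero_divisor_graph : sgraph R :=
  SGraph szd_adj_vertex szd_adj_irr szd_adj_sym.

End StrongZeroDivisorGraph.

Arguments strong_zero_divisor_graph : clear implicits.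

(* Main.v *)
Require Import Defs.
From mathcomp Require Import all_boot all_algebra.
From mathcomp Require Import boolp classical_sets cardinality.

(** Every right annihilator [r(aR)] is a two-sided ideal, so its generating
    projection [e] is central, and the central cover [c = 1 - e] of [a] satisfies
    [aRx = 0 <-> cx = 0].  Thus the vertices are the elements whose cover is
    neither [0] nor [1], and distinct vertices are adjacent in the complement
    iff their covers have a nonzero product.  If [e] is a central projection and
    [CP(R) = {0, 1, e, 1 - e}], then covers are constant along paths, so [e] and
    [1 - e] are not joined.  Otherwise two vertices with orthogonal covers are
    both adjacent to a single central projection. *)

Import GRing.Theory.
Local Open Scope classical_set_scope.
Local Open Scope card_scope.
Local Open Scope ring_scope.

(** * Cardinality bounds and finite lists *)

Lemma card_geII_notin (T : choiceType) (A : set T) (n : nat) (t : seq T) :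
  `I_n #<= A -> (size t < n)%N -> exists2 x, A x & x \notin t.
Proof.
move=> nA tn; apply: contrapT => noA.
have At : A `<=` [set` t].
  by move=> x Ax; apply: contrapT => /negP xt; apply: noA; exists x.
have : `I_n #<= `I_(size t).
  apply: (card_le_trans nA); apply: (card_le_trans (subset_card_le At)).
  (* [nth] needs a default element, so the empty list is treated apart. *)
  case: t {tn noA At} => [|x0 t]; first by rewrite set_nil card_ge0.
  apply: (@card_le_trans _ _ _ (nth x0 (x0 :: t) @` `I_(size (x0 :: t)))).
    apply: subset_card_le => x /= /(nthP x0)[i it <-].
    by exists i.
  exact: card_image_le.
by rewrite card_le_II leqNgt tn.
Qed.

Lemma card_geII_uniq (T : choiceType) (A : set T) (s : seq T) :
  uniq s -> (forall x, x \in s -> A x) -> `I_(size s) #<= A.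
Proof.
case: s => [|x0 s] us sA; first by rewrite II0 card_ge0.
have inj : {in `I_(size (x0 :: s)) &, injective (nth x0 (x0 :: s))}.
  move=> i j; rewrite !inE => /= hi hj /eqP; rewrite nth_uniq// => /eqP//.
have := inj_card_eq inj; rewrite card_eq_le => /andP[_ /card_le_trans]; apply.
by apply: subset_card_le => _ [i /= hi <-]; apply: sA; rewrite mem_nth.
Qed.

Section CentralCover.
Local Set Implicit Arguments.
Local Unset Strict Implicit.
Variable R : starRingType.
Implicit Types (a b c d e x : R).

Local Notation CP := (central_projections R).

(** * Central projections *)

Lemma star1 : star (1 : R) = 1.
Proof.
by rewrite -{2}[1](starK (1 : R)) -[in RHS](mulr1 (star 1)) starM starK mulr1.
Qed.

Lemma starN x : star (- x) = - star x.
Proof. by apply: (addIr (star x)); rewrite -starD !addNr star0. Qed.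

Lemma central_projection0 : CP 0.
Proof.
by split; [split; rewrite ?mul0r ?star0|move=> x; rewrite mul0r mulr0].
Qed.

Lemma central_projection_compl e : CP e -> CP (1 - e).
Proof.
move=> [[ee se] ce]; split; first split.
- by rewrite mulrBr mulr1 mulrBl mul1r ee subrr subr0.
- by rewrite starD starN star1 se.
- by move=> x; rewrite mulrBl mulrBr mul1r mulr1 ce.
Qed.

Lemma central_projection1 : CP 1.
Proof.
by rewrite -[1]subr0; apply/central_projection_compl/central_projection0.
Qed.

Lemma central_projectionD e d : CP e -> CP d -> e * d = 0 -> CP (e + d).
Proof.
move=> [[ee se] ce] [[dd sd] cd] ed; split; first split.
- by rewrite mulrDl !mulrDr ee dd -(ce d) ed addr0 add0r.
- by rewrite starD se sd.
- by move=> x; rewrite mulrDl mulrDr ce cd.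
Qed.

Lemma projection_mul_compl e : projection e -> e * (1 - e) = 0.
Proof. by case=> ee _; rewrite mulrBr mulr1 ee subrr. Qed.

(** The hypothesis says that [e * R] is also a left ideal; starring it at [star x] gives
    [e * x * e = e * x]. *)
Lemma projection_ideal_central e :
  projection e -> (forall x, e * (x * e) = x * e) -> central e.
Proof.
move=> [ee se] ide x; rewrite -ide mulrA; apply: (can_inj starK).
by rewrite !starM se ide.
Qed.

(** * Central covers *)

Definition central_cover a c : Prop :=
  CP c /\ forall x, (forall r, a * r * x = 0) <-> c * x = 0.

Lemma right_annihilatorE a x :
  right_annihilator (principal_right_ideal a) x <-> forall r, a * r * x = 0.
Proof.
by split=> [h r|h _ [r _ <-]//]; apply: h; exists r.
Qed.

Lemma pq_Baer_central_cover a : pq_Baer R -> exists c, central_cover a c.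
Proof.
move=> /(_ a)[e pe rae]; have [ee _] := pe.
have eE x : (forall r, a * r * x = 0) <-> e * x = x.
  rewrite -right_annihilatorE rae; split=> [[y _ <-]|<-]; last by exists x.
  by rewrite mulrA ee.
(* The annihilator of [a * R] absorbs left factors: [a * r * (x * e) = a * (r * x) * e = 0]. *)
have ce : central e.
  apply: projection_ideal_central => // x; apply/eE => r.
  by have /eE/(_ (r * x)) := ee; rewrite !mulrA.
exists (1 - e); split; first exact: central_projection_compl.
move=> x; rewrite eE mulrBl mul1r; split=> [->|/subr0_eq//].
by rewrite subrr.
Qed.

Lemma central_cover_self c : CP c -> central_cover c c.
Proof.
move=> Cc; split=> // x; split=> [/(_ 1)|cx r]; first by rewrite mulr1.
by have [_ ->] := Cc; rewrite -mulrA cx mulr0.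
Qed.

(** Since [c] kills [1 - c], so does every [a * r]; take [r = 1]. *)
Lemma central_cover_id a c : central_cover a c -> a * c = a.
Proof.
case=> -[pc _] /(_ (1 - c))[_ /(_ (projection_mul_compl pc))/(_ 1)].
by rewrite mulr1 mulrBr mulr1 => /subr0_eq.
Qed.

Lemma central_cover_vertex a c :
  central_cover a c -> szd_vertex a <-> c <> 0 /\ c <> 1.
Proof.
move=> ac; have aE := central_cover_id ac; have [[pc _] h] := ac; split.
- move=> [a0 na]; split=> c01; first by apply: a0; rewrite -aE c01 mulr0.
  apply: na; apply/seteqP; split=> x /=.
  + by move=> /right_annihilatorE/h; rewrite c01 mul1r.
  + by move=> ->; apply/right_annihilatorE => r; rewrite mulr0.
- move=> [c0 c1]; split=> [a0|na].
  + apply: c0; rewrite -[c]mulr1; apply/h => r.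
    by rewrite a0 !mul0r.
  + have : [set 0 : R] (1 - c).
      by rewrite -na; apply/right_annihilatorE/h/projection_mul_compl.
    by move=> /= /subr0_eq/esym.
Qed.

(** The cover property is used once for each factor: the involution turns [c * star b = 0] into
    [b * c = 0], and centrality of [c] lets any [r] stand between [b] and [c]. *)
Lemma central_cover_orthogonal a b c d :
  central_cover a c -> central_cover b d ->
  (forall r, a * r * star b = 0) <-> c * d = 0.
Proof.
move=> [[[_ sc] cc] ha] [_ hb]; rewrite ha [c * d]cc; split=> [h|/hb h].
- apply/hb => r; rewrite -mulrA -cc mulrA; apply: (can_inj starK).
  by rewrite star0 !starM sc h mulr0.
- apply: (can_inj starK); rewrite star0 starM starK sc.
  by have := h 1; rewrite mulr1.
Qed.

(** * Paths in the complement graph *)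

Local Notation G := (complement (strong_zero_divisor_graph R)).

Lemma complement_adjP a b c d : central_cover a c -> central_cover b d ->
  adj G a b <-> [/\ szd_vertex a, szd_vertex b, a <> b & c * d <> 0].
Proof.
move=> ac bd; have o := central_cover_orthogonal ac bd.
split=> [[va vb ab nab]|[va vb ab cd]]; split=> // h.
- by apply: nab; split=> //; apply/o.
- by case: h => _ _ _ /o.
Qed.

Lemma complement_adj_meet a b c d g :
  central_cover a c -> central_cover b d -> szd_vertex a -> szd_vertex b ->
  c * d = 0 -> CP g -> g <> 1 -> g * c <> 0 -> g * d <> 0 ->
  adj G a g /\ adj G g b.
Proof.
move=> ac bd va vb cd Cg g1 gc gd.
have gg := central_cover_self Cg.
have vg : szd_vertex g.
  by apply/(central_cover_vertex gg); split=> // g0; apply: gc; rewrite g0 mul0r.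
have [_ zg] := Cg.
split; [apply/(complement_adjP ac gg)|apply/(complement_adjP gg bd)].
- split=> //; last by rewrite -zg.
  (* As [c * d = 0], [d] is annihilated by [a * R], so [a = g] would force [g * d = 0].
     Symmetrically, [g = b] would force [g * c = 0]. *)
  move=> ag; apply: gd; apply/gg.2; rewrite -ag.
  exact/ac.2.
- split=> // gb; apply: gc; apply/gg.2; rewrite gb.
  by apply/bd.2; have [[_ zc] _] := ac; rewrite -zc.
Qed.

(* If [d = 1 - c], one of [g], [1 - g] meets both [c] and [1 - c], for any
   central projection [g] other than [0], [1], [c], [1 - c]. *)
Lemma exists_central_projection_meet c d :
  `I_6 #<= CP -> CP c -> CP d -> c <> 0 -> d <> 0 -> c * d = 0 ->
  exists g, [/\ CP g, g <> 1, g * c <> 0 & g * d <> 0].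
Proof.
move=> C6 Cc Cd c0 d0 cd.
have [[pc zc] [pd zd]] := (Cc, Cd).
have [s1|s1] := pselect (c + d = 1); last first.
  (* The sum itself works: its products with [c] and [d] are [c] and [d]. *)
  exists (c + d); split=> //; first exact: central_projectionD.
    by rewrite mulrDl pc.1 zd cd addr0.
  by rewrite mulrDl pd.1 cd add0r.
have dE : d = 1 - c by rewrite -s1 addrC addKr.
have [g Cg] := @card_geII_notin _ _ _ [:: 0; 1; c; d] C6 isT.
rewrite !inE !negb_or => /and4P[/eqP g0 /eqP g1 /eqP gc /eqP gd].
(* If [g * d = 0], then [g = g * c] and [(1 - g) * d = d]; moreover [(1 - g) * c = 0] would give
   [g = c]. The case [g * c = 0] is symmetric. *)
have gE : g = g * c + g * d by rewrite -mulrDr s1 mulr1.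
have [gc0|gc0] := pselect (g * c = 0); last first.
  have [gd0|gd0] := pselect (g * d = 0); last by exists g.
  exists (1 - g); split; first exact: central_projection_compl.
  - by move=> h; apply: g0; rewrite -[g](subKr 1) h subrr.
  - rewrite mulrBl mul1r => /subr0_eq; apply/nesym => h.
    by apply: gc; rewrite gE gd0 addr0.
  - by rewrite mulrBl mul1r gd0 subr0.
exists (1 - g); split; first exact: central_projection_compl.
- by move=> h; apply: g0; rewrite -[g](subKr 1) h subrr.
- by rewrite mulrBl mul1r gc0 subr0.
- rewrite mulrBl mul1r => /subr0_eq; apply/nesym => h.
  by apply: gd; rewrite gE gc0 add0r.
Qed.

Lemma complement_connected : pq_Baer R -> `I_6 #<= CP -> connected G.
Proof.
move=> bR C6 a b /= va vb.
have [c ac] := pq_Baer_central_cover a bR.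
have [d bd] := pq_Baer_central_cover b bR.
have [[c0 _] [d0 _]] :=
  ((central_cover_vertex ac).1 va, (central_cover_vertex bd).1 vb).
have [->|ab] := pselect (a = b); first by exists [::].
have [cd|cd] := pselect (c * d = 0); last first.
  exists [:: b] => //=; rewrite andbT; apply/asboolP.
  exact/(complement_adjP ac bd).
have [g [Cg g1 gc gd]] := exists_central_projection_meet C6 ac.1 bd.1 c0 d0 cd.
have [ag gb] := complement_adj_meet ac bd va vb cd Cg g1 gc gd.
by exists [:: g; b] => //=; rewrite andbT; apply/andP; split; apply/asboolP.
Qed.

(** * Connectedness forces six central projections *)

Lemma path_central_cover e a p :
  pq_Baer R -> CP `<=` [set` [:: 0; 1; e; 1 - e]] ->
  central_cover a e -> path (fun u v => `[< adj G u v >]) a p ->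
  central_cover (last a p) e.
Proof.
move=> bR C4; elim: p a => [//|b p IH] a ae /= /andP[/asboolP ab]; apply: IH.
have [d bd] := pq_Baer_central_cover b bR.
have [va vb _ ed] := (complement_adjP ae bd).1 ab.
have [d0 d1] := (central_cover_vertex bd).1 vb.
(* Being a vertex excludes covers [0] and [1]; adjacency excludes [1 - e], which is orthogonal to
   [e]. *)
have := C4 _ bd.1; rewrite /= !inE => /or4P[]/eqP dE //; first by rewrite -dE.
by case: ed; rewrite dE; apply/projection_mul_compl/ae.1.1.
Qed.

Lemma connected_exists_central_projection e :
  pq_Baer R -> CP e -> e <> 0 -> e <> 1 -> connected G ->
  exists2 g, CP g & g \notin [:: 0; 1; e; 1 - e].
Proof.
move=> bR Ce e0 e1 conn; apply: contrapT => noC.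
have C4 : CP `<=` [set` [:: 0; 1; e; 1 - e]].
  by move=> x Cx; apply: contrapT => /negP xt; apply: noC; exists x.
have C'e := central_projection_compl Ce.
have [ee ee'] := (central_cover_self Ce, central_cover_self C'e).
have e'0 : 1 - e <> 0 by move=> /subr0_eq/esym.
have e'1 : 1 - e <> 1 by move=> h; apply: e0; rewrite -[e](subKr 1) h subrr.
have [p ep lp] := conn e (1 - e) ((central_cover_vertex ee).2 (conj e0 e1))
  ((central_cover_vertex ee').2 (conj e'0 e'1)).
(* The path would make [e] a cover of [1 - e], hence [1 - e = (1 - e) * e = 0]. *)
have := path_central_cover bR C4 ee ep; rewrite lp => /central_cover_id.
have [_ ze] := Ce; rewrite -ze projection_mul_compl; last exact: Ce.1.
by move=> /esym.
Qed.

Lemma card_central_projections_ge6 e g :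
  CP e -> CP g -> e <> 0 -> e <> 1 -> g \notin [:: 0; 1; e; 1 - e] ->
  `I_6 #<= CP.
Proof.
move=> Ce Cg e0 e1.
rewrite !inE !negb_or => /and4P[/eqP g0 /eqP g1 /eqP ge /eqP ge'].
(* If [x = 1 - x], then [x = x * x = x * (1 - x) = 0]. *)
have compl_neq x : CP x -> x <> 0 -> x <> 1 - x.
  by move=> [px _] x0 xx; apply: x0; rewrite -px.1 {2}xx projection_mul_compl.
have eqC (x y : R) : 1 - x = y -> x = 1 - y by move=> <-; rewrite subKr.
have one0 : (1 : R) <> 0 by move=> h; apply: e0; rewrite -[e]mulr1 h mulr0.
(* Complementation is an involution, so each coincidence reduces to one already excluded. *)
have u : uniq [:: 0; 1; e; 1 - e; g; 1 - g].
  rewrite /= !inE !negb_or /=; do !(apply/andP; split) => //;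
    apply/eqP => /esym h //.
  - by apply: e1; rewrite (eqC _ _ h) subr0.
  - by apply: g1; rewrite (eqC _ _ h) subr0.
  - by apply: e0; rewrite (eqC _ _ h) subrr.
  - by apply: g0; rewrite (eqC _ _ h) subrr.
  - exact: (compl_neq e Ce).
  - by apply: ge'; rewrite (eqC _ _ h).
  - by apply: ge; rewrite -(subKr 1 g) h subKr.
  - exact: (compl_neq g Cg).
apply: (card_geII_uniq _ _ _ u) => x; rewrite !inE.
have [C0 C1] := (central_projection0, central_projection1).
have [Ce' Cg'] := (central_projection_compl Ce, central_projection_compl Cg).
by do 5?[case/orP => [/eqP->//|]]; move=> /eqP->.
Qed.

End CentralCover.

Local Close Scope ring_scope.

Theorem theorem4p7 (R : starRingType) :
  pq_Baer R ->
  `I_4 #<= central_projections R ->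
  (connected (complement (strong_zero_divisor_graph R)) <->
   `I_6 #<= central_projections R).
Proof.
move=> bR C4; split=> [conn|]; last exact: complement_connected.
have [e Ce] := @card_geII_notin _ _ _ [:: 0%R; 1%R] C4 isT.
rewrite !inE !negb_or => /andP[/eqP e0 /eqP e1].
have [g Cg ng] := connected_exists_central_projection bR Ce e0 e1 conn.
exact: card_central_projections_ge6 Ce Cg e0 e1 ng.
Qed.
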